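(* Let $H$ be a Hilbert space and $(A_i)_{i\in I}$ a family of pairwise commuting compact operators on $H$ such that $\sum_{i\in I}A_i^*A_i=1$, with convergence in the strong operator topology. Then there is an orthogonal decomposition $H=H_{qn}\oplus H_{n}$ into closed subspaces, each invariant under all $A_i$, such that every restriction $A_i|_{H_n}$ is normal and every restriction $A_i|_{H_{qn}}$ is quasi-nilpotent.
   Context: An operator on a Banach space is quasi-nilpotent if its spectrum is $\{0\}$ (equivalently, its spectral radius is $0$). The sum over the (possibly infinite) index set $I$ is the strong limit of the net of finite partial sums. *)

(* Defs.v *)
From HB Require Import structures.
From mathcomp Require Import all_boot all_order all_algebra finmap.
From mathcomp Require Import all_classical all_reals all_analysis.
From mathcomp Require Import complex.
Set Implicit Arguments. Unset Strict Implicit. Unset Printing Implicit Defensive.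
Import Order.TTheory GRing.Theory Num.Theory.
Import numFieldNormedType.Exports.
Local Open Scope classical_set_scope.
Local Open Scope ring_scope.

Section Hilbert.
Variable R : realType.
Variable H : completeNormedModType R[i].

(* ip is an inner product (linear in the first argument, conjugate symmetric)
   inducing the norm of H: |x|^2 = <x,x>.  Together with completeness of H
   this makes (H, ip) a complex Hilbert space. *)
Definition inner_product (ip : H -> H -> R[i]) : Prop :=
  [/\ forall (a : R[i]) (x y z : H), ip (a *: x + y) z = a * ip x z + ip y z,
      forall x y : H, ip y x = conjc (ip x y)
    & forall x : H, `|x| ^+ 2 = ip x x].

Definition linear_op (T : H -> H) : Prop :=
  forall (a : R[i]) (x y : H), T (a *: x + y) = a *: T x + T y.

Definition is_adjoint (ip : H -> H -> R[i]) (T S : H -> H) : Prop :=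
  forall x y : H, ip (T x) y = ip x (S y).

Definition compact_op (T : H -> H) : Prop :=
  linear_op T /\ compact (closure (T @` [set x : H | `|x| <= 1])).

Definition closed_subspace (M : set H) : Prop :=
  [/\ M 0, forall (a : R[i]) (x y : H), M x -> M y -> M (a *: x + y)
    & closed M].

Definition invariant_under (T : H -> H) (M : set H) : Prop :=
  forall x, M x -> M (T x).

Definition orth_decomp (ip : H -> H -> R[i]) (M N : set H) : Prop :=
  (forall x y, M x -> N y -> ip x y = 0) /\
  (forall z : H, exists x y, [/\ M x, N y & z = x + y]).

Definition invertible_on (M : set H) (T : H -> H) : Prop :=
  exists B : H -> H,
    [/\ invariant_under B M,
        exists C : R[i], forall y, M y -> `|B y| <= C * `|y|,
        forall x, M x -> B (T x) = x
      & forall y, M y -> T (B y) = y].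

Definition spectrum_on (M : set H) (T : H -> H) : set R[i] :=
  [set l | ~ invertible_on M (fun x => T x - l *: x)].

Definition quasinilpotent_on (M : set H) (T : H -> H) : Prop :=
  spectrum_on M T `<=` [set 0].

Definition normal_on (ip : H -> H -> R[i]) (M : set H) (T : H -> H) : Prop :=
  exists S : H -> H,
    [/\ invariant_under S M,
        forall x y, M x -> M y -> ip (T x) y = ip x (S y)
      & forall x, M x -> T (S x) = S (T x)].

End Hilbert.

Section fin_subsets_net.
Local Open Scope fset_scope.
Definition fin_subsets_net {I : choiceType} : set_system {fset I} :=
  filter_from setT (fun A => [set B | A `<=` B]).

Instance fin_subsets_net_filter {I : choiceType} : ProperFilter (@fin_subsets_net I).
Proof.
eapply filter_from_proper; last by move=> A _; exists A; rewrite /= fsubset_refl.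
apply: filter_fromT_filter; first by exists fset0.
by move=> A B /=; exists (A `|` B) => P /=; rewrite fsubUset => /andP[].
Qed.

Definition fin_partial_sum {I : choiceType} {V : zmodType}
  (x : I -> V) (A : {fset I}) : V := \sum_(i : A) x (val i).
End fin_subsets_net.

(* Main.v *)
Require Import Defs.
From HB Require Import structures.
From mathcomp Require Import all_boot all_order all_algebra finmap.
From mathcomp Require Import all_classical all_reals all_analysis.
From mathcomp Require Import complex ring lra.
Import Order.TTheory GRing.Theory Num.Theory.
Import numFieldNormedType.Exports.
Local Open Scope classical_set_scope.
Local Open Scope ring_scope.
Set Implicit Arguments. Unset Strict Implicit. Unset Printing Implicit Defensive.

(** Let [E] be the set of joint eigenvectors of the family, [Hqn] the orthogonal
    complement of [E] and [Hn] that of [Hqn].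

    If [A_i v = lam_i v] for all [i] and [w := A_j^* v], then expanding
    [|v|^2 |A_i w - lam_i w|^2] and using that the [A_i] commute turns it into
    terms that only involve [A_i^* A_i w] and [A_i^* A_i v]; summed over [i] they
    give [|v|^2 |w|^2 - 2 |v|^2 |w|^2 + |w|^2 |v|^2 = 0].  So [E] is stable under
    every [A_j^*], whence [Hqn] and [Hn] are invariant under all [A_j] and
    [A_j^*], and [A_j] commutes with [A_j^*] on [E], hence on [Hn].

    If [A_j] had a nonzero spectral value on [Hqn], the Riesz theory of compact
    operators would give a nonzero eigenspace in [Hqn], invariant under the
    commuting [A_i] and of finite dimension, hence a nonzero joint eigenvector
    in [Hqn], although [Hqn] is orthogonal to [E]. *)

(** * Real-valued norms and compact sets *)

Lemma natSinv_lt (R : archiRealFieldType) (e : R) : 0 < e ->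
  exists N : nat, forall n, (N <= n)%N -> n.+1%:R^-1 < e.
Proof.
move=> e0; exists (Num.bound e^-1) => n Nn.
rewrite -[ltRHS]invrK ltf_pV2 ?posrE ?invr_gt0 //.
have eP : e^-1 < (Num.bound e^-1)%:R by apply: archi_boundP; rewrite invr_ge0 ltW.
by rewrite (lt_le_trans eP) // ler_nat leqW.
Qed.

Section RealNorm.
Context {R : realType} {H : completeNormedModType R[i]}.
Implicit Types (x y z : H) (a l : R[i]).

(* Norms in [H] take values in [R[i]]; [rnorm] lands in the totally ordered
   field [R], where [lra] and infima are available. *)
Definition rnorm x : R := complex.Re `|x|.

Lemma real_of_ge0 a : 0 <= a -> a = (complex.Re a)%:C%C.
Proof. by case: a => u v; rewrite lecE /= => /andP[/eqP ->]. Qed.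

Lemma norm_rnormE x : `|x| = (rnorm x)%:C%C.
Proof. exact: (real_of_ge0 (normr_ge0 _)). Qed.

Lemma normcE_Re a : `|a| = (complex.Re `|a|)%:C%C.
Proof. exact: (real_of_ge0 (normr_ge0 _)). Qed.

Lemma Re_normc_ge0 a : 0 <= complex.Re `|a|.
Proof. by rewrite -lecR -normcE_Re normr_ge0. Qed.

Lemma Re_normc_gt0 a : a != 0 -> 0 < complex.Re `|a|.
Proof. by rewrite -normr_gt0 normcE_Re ltcR. Qed.

Lemma rnorm_ge0 x : 0 <= rnorm x.
Proof. by rewrite -lecR -norm_rnormE normr_ge0. Qed.

Lemma rnorm0 : rnorm 0 = 0.
Proof. by rewrite /rnorm normr0. Qed.

Lemma rnorm0_eq0 x : rnorm x = 0 -> x = 0.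
Proof. by move=> x0; apply/eqP; rewrite -normr_eq0 norm_rnormE x0. Qed.

Lemma rnorm_gt0 x : x != 0 -> 0 < rnorm x.
Proof.
move=> x0; rewrite lt_neqAle rnorm_ge0 andbT eq_sym.
by apply: contra x0 => /eqP/rnorm0_eq0 ->.
Qed.

Lemma ler_rnormD x y : rnorm (x + y) <= rnorm x + rnorm y.
Proof. by rewrite -lecR rmorphD /= -!norm_rnormE ler_normD. Qed.

Lemma rnormN x : rnorm (- x) = rnorm x.
Proof. by rewrite /rnorm normrN. Qed.

Lemma rdistC x y : rnorm (x - y) = rnorm (y - x).
Proof. by rewrite -rnormN opprB. Qed.

Lemma ler_rdistD z x y : rnorm (x - y) <= rnorm (x - z) + rnorm (z - y).
Proof. by rewrite -[x in leLHS](subrK z) -addrA ler_rnormD. Qed.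

Lemma rnormZ a x : rnorm (a *: x) = complex.Re `|a| * rnorm x.
Proof. by apply: complexI; rewrite rmorphM /= -normcE_Re -!norm_rnormE normrZ. Qed.

Lemma rnormZ_real (t : R) x : 0 <= t -> rnorm (t%:C%C *: x) = t * rnorm x.
Proof. by move=> t0; rewrite rnormZ ger0_norm ?ler0c. Qed.

Lemma rnormZV x : x != 0 -> rnorm ((rnorm x)^-1%:C%C *: x) = 1.
Proof.
move=> /rnorm_gt0 n0.
by rewrite rnormZ_real ?invr_ge0 ?rnorm_ge0 // mulVf ?gt_eqF.
Qed.

Lemma nbhs_rnormP x (P : set H) :
  nbhs x P <-> exists2 e : R, 0 < e & forall y, rnorm (x - y) < e -> P y.
Proof.
split.
  move=> /nbhs_normP[e /= e0 eP]; exists (complex.Re e).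
    by rewrite -ltcR -real_of_ge0 // ltW.
  move=> y xy; apply: eP => /=.
  by rewrite norm_rnormE (real_of_ge0 (ltW e0)) ltcR.
move=> [e e0 eP]; apply/nbhs_normP; exists e%:C%C; first by rewrite /= ltcR.
by move=> y /=; rewrite norm_rnormE ltcR; exact: eP.
Qed.

Lemma closure_rnormP (M : set H) x :
  closure M x <-> forall e : R, 0 < e -> exists2 y, M y & rnorm (x - y) < e.
Proof.
split.
  move=> Mx e e0; have [|y [My xy]] := Mx [set y | rnorm (x - y) < e].
    by apply/nbhs_rnormP; exists e.
  by exists y.
move=> MP B /nbhs_rnormP[e e0 eB]; have [y My xy] := MP e e0.
by exists y; split => //; exact: eB.
Qed.

(** A cluster point replaces a convergent subsequence: arbitrarily late terms near [p] are all that
    the arguments below use. *)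
Lemma compact_cluster_seq (K : set H) (u : nat -> H) :
  compact K -> (forall n, K (u n)) ->
  exists p, forall e : R, 0 < e -> forall N : nat,
    exists2 n : nat, (N <= n)%N & rnorm (u n - p) < e.
Proof.
move=> cK Ku; have uK : (u @ \oo) K by exists 0%N => // n _; exact: Ku.
have [p [_ pu]] := cK (u @ \oo) _ uK.
exists p => e e0 N.
have uN : (u @ \oo) [set u n | n in [set n | (N <= n)%N]].
  by exists N => // n /= Nn; exists n.
have pe : nbhs p [set y | rnorm (p - y) < e] by apply/nbhs_rnormP; exists e.
have [_ [[n Nn <-] nB]] := pu _ _ uN pe.
by exists n => //; rewrite rdistC.
Qed.

Lemma compact_not_separated (K : set H) (u : nat -> H) (d : R) :
  compact K -> (forall n, K (u n)) -> 0 < d ->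
  ~ (forall m n : nat, (m < n)%N -> d <= rnorm (u m - u n)).
Proof.
move=> cK Ku d0 sep; have [p pu] := compact_cluster_seq cK Ku.
have [m _ mp] := pu (d / 2) ltac:(lra) 0%N.
have [n mn np] := pu (d / 2) ltac:(lra) m.+1.
have := sep _ _ mn; have := ler_rdistD p (u m) (u n); rewrite (rdistC p).
lra.
Qed.

Lemma compact_rnorm_bounded (K : set H) :
  compact K -> exists2 C : R, 0 <= C & forall x, K x -> rnorm x <= C.
Proof.
move=> cK; apply: contrapT => nb.
have u_ n : exists x, K x /\ n%:R < rnorm x.
  apply: contrapT => nx; apply: nb; exists n%:R => // x Kx.
  by rewrite leNgt; apply/negP => xn; apply: nx; exists x.
pose u n := projT1 (cid (u_ n)).
have uP n : K (u n) /\ n%:R < rnorm (u n) by rewrite /u; case: cid.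
have [p pu] := compact_cluster_seq cK (fun n => (uP n).1).
have [N pN] : exists N : nat, rnorm p + 1 < N%:R.
  by exists (Num.bound (rnorm p + 1)); apply: archi_boundP;
    rewrite addr_ge0 ?rnorm_ge0.
have [n Nn np] := pu 1 ltr01 N.
have := ler_rnormD (u n - p) p; rewrite subrK.
have := (uP n).2; have : (N%:R <= n%:R :> R) by rewrite ler_nat.
lra.
Qed.

Lemma rnorm_complete (u : nat -> H) :
  (forall e : R, 0 < e -> exists N : nat, forall m n, (N <= m)%N -> (N <= n)%N ->
     rnorm (u m - u n) < e) ->
  exists p, forall e : R, 0 < e -> exists N : nat, forall n, (N <= n)%N ->
    rnorm (p - u n) < e.
Proof.
move=> uC.
have /cauchy_cvgP/cvg_ex[p up] : cauchy (u @ \oo).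
  apply: cauchy_exP => e e0.
  have [|N uN] := uC (complex.Re e).
    by rewrite -ltcR -real_of_ge0 // ltW.
  exists (u N); exists N => // n /= Nn.
  by rewrite -ball_normE /= norm_rnormE (real_of_ge0 (ltW e0)) ltcR uN.
exists p => e e0.
have /(up _) [N _ uN] : nbhs p [set y | rnorm (p - y) < e].
  by apply/nbhs_rnormP; exists e.
by exists N => n Nn; exact: uN.
Qed.

End RealNorm.
(** * Inner products and orthogonal projections *)

Section InnerProduct.
Context {R : realType} {H : completeNormedModType R[i]}.
Variable ip : H -> H -> R[i].
Hypothesis ipP : inner_product ip.
Implicit Types (x y z v : H) (a l : R[i]) (M E : set H).

(** This real inner product induces the same norm, so expansions of squared norms stay in the
    ordered field [R]. *)
Definition rip x y : R := complex.Re (ip x y).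

Definition perp E : set H := [set x | forall v, E v -> ip x v = 0].

Let ip_linear a x y z : ip (a *: x + y) z = a * ip x z + ip y z.
Proof. by case: ipP. Qed.

Lemma ipC x y : ip y x = conjc (ip x y).
Proof. by case: ipP. Qed.

Lemma ip0l z : ip 0 z = 0.
Proof.
by have := ip_linear 1 0 0 z; rewrite scaler0 addr0 mul1r -[LHS]addr0 => /addrI.
Qed.

Lemma ipDl x y z : ip (x + y) z = ip x z + ip y z.
Proof. by rewrite -{1}[x]scale1r ip_linear mul1r. Qed.

Lemma ipZl a x z : ip (a *: x) z = a * ip x z.
Proof. by rewrite -[a *: x]addr0 ip_linear ip0l addr0. Qed.

Lemma ipNl x z : ip (- x) z = - ip x z.
Proof. by rewrite -scaleN1r ipZl mulN1r. Qed.

Lemma ipBl x y z : ip (x - y) z = ip x z - ip y z.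
Proof. by rewrite ipDl ipNl. Qed.

Lemma ip0r z : ip z 0 = 0.
Proof. by rewrite ipC ip0l conjc0. Qed.

Lemma ipZr a x z : ip z (a *: x) = conjc a * ip z x.
Proof. by rewrite ipC ipZl rmorphM /= -!ipC. Qed.

Lemma ipBr x y z : ip z (x - y) = ip z x - ip z y.
Proof. by rewrite ipC ipBl rmorphB /= -!ipC. Qed.

Lemma ip_suml (I : Type) (s : seq I) (P : pred I) (f : I -> H) z :
  ip (\sum_(i <- s | P i) f i) z = \sum_(i <- s | P i) ip (f i) z.
Proof. exact: (big_morph (ip^~ z) (fun x y => ipDl x y z) (ip0l z)). Qed.

Lemma ip_eq0C x y : ip x y = 0 -> ip y x = 0.
Proof. by rewrite (ipC x y) => ->; rewrite conjc0. Qed.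

Lemma ripC x y : rip x y = rip y x.
Proof. by rewrite /rip ipC; case: (ip y x). Qed.

Lemma rip0l z : rip 0 z = 0.
Proof. by rewrite /rip ip0l. Qed.

Lemma ripDl x y z : rip (x + y) z = rip x z + rip y z.
Proof. by rewrite /rip ipDl raddfD. Qed.

Lemma ripBl x y z : rip (x - y) z = rip x z - rip y z.
Proof. by rewrite /rip ipBl raddfB. Qed.

Lemma ripBr x y z : rip z (x - y) = rip z x - rip z y.
Proof. by rewrite !(ripC z) ripBl. Qed.

Lemma ripDr x y z : rip z (x + y) = rip z x + rip z y.
Proof. by rewrite !(ripC z) ripDl. Qed.

Lemma ripZl (t : R) x y : rip (t%:C%C *: x) y = t * rip x y.
Proof. by rewrite /rip ipZl; case: (ip x y) => u w /=; rewrite mul0r subr0. Qed.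

Lemma ripZr (t : R) x y : rip x (t%:C%C *: y) = t * rip x y.
Proof. by rewrite !(ripC x) ripZl. Qed.

Lemma rip_suml (I : Type) (s : seq I) (P : pred I) (f : I -> H) z :
  rip (\sum_(i <- s | P i) f i) z = \sum_(i <- s | P i) rip (f i) z.
Proof. exact: (big_morph (rip^~ z) (fun x y => ripDl x y z) (rip0l z)). Qed.

Lemma rip_sqr x : rip x x = rnorm x ^+ 2.
Proof.
case: ipP => _ _ /(_ x); rewrite norm_rnormE -rmorphXn /= /rip => <- //.
Qed.

Lemma ip_norm x : ip x x = (rnorm x ^+ 2)%:C%C.
Proof. by case: ipP => _ _ /(_ x) <-; rewrite norm_rnormE rmorphXn. Qed.

Lemma ip_eq0 x : ip x x = 0 -> x = 0.
Proof.
by rewrite ip_norm => -[] /eqP; rewrite sqrf_eq0 => /eqP/rnorm0_eq0.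
Qed.

Lemma rnorm_sqrD x y :
  rnorm (x + y) ^+ 2 = rnorm x ^+ 2 + 2 * rip x y + rnorm y ^+ 2.
Proof. by rewrite -!rip_sqr ripDl !ripDr (ripC y); ring. Qed.

Lemma rnorm_sqrB x y :
  rnorm (x - y) ^+ 2 = rnorm x ^+ 2 - 2 * rip x y + rnorm y ^+ 2.
Proof. by rewrite -!rip_sqr ripBl !ripBr (ripC y); ring. Qed.

Lemma parallelogram x y :
  rnorm (x + y) ^+ 2 + rnorm (x - y) ^+ 2 = 2 * (rnorm x ^+ 2 + rnorm y ^+ 2).
Proof. by rewrite rnorm_sqrD rnorm_sqrB; ring. Qed.

Lemma rip_le x y : `|rip x y| <= rnorm x * rnorm y.
Proof.
have [->|y0] := eqVneq y 0.
  by rewrite ripC rip0l normr0 mulr_ge0 ?rnorm_ge0.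
have n0 := rnorm_gt0 y0.
(* The real coefficient [t] minimises the norm of [x - t y]; nonnegativity of the minimum is the
   Cauchy-Schwarz inequality. *)
set t := rip x y / rnorm y ^+ 2.
have := sqr_ge0 (rnorm (x - t%:C%C *: y)).
rewrite rnorm_sqrB ripZr -(rip_sqr (_ *: y)) ripZl ripZr rip_sqr.
have -> : rnorm x ^+ 2 - 2 * (t * rip x y) + t * (t * rnorm y ^+ 2) =
    (rnorm x ^+ 2 * rnorm y ^+ 2 - rip x y ^+ 2) / rnorm y ^+ 2.
  by rewrite /t; field; rewrite gt_eqF.
rewrite pmulr_lge0 ?invr_gt0 ?exprn_gt0 // subr_ge0 -exprMn => le2.
rewrite -(@ler_pXn2r _ 2) ?nnegrE ?normr_ge0 ?mulr_ge0 ?rnorm_ge0 //.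
by rewrite real_normK ?num_real.
Qed.

(** Taking [a = ip x y] turns the hypothesis into the vanishing of the squared modulus of [ip x y].
    This reduces complex orthogonality to estimates on [rip]. *)
Lemma rip_all_eq0 x y : (forall a, rip x (a *: y) = 0) -> ip x y = 0.
Proof.
move=> /(_ (ip x y)); rewrite /rip ipZr.
case: (ip x y) => u w /= h; have : u ^+ 2 + w ^+ 2 = 0 by rewrite -h; ring.
move=> /eqP; rewrite paddr_eq0 ?sqr_ge0 // !sqrf_eq0.
by move=> /andP[/eqP-> /eqP->].
Qed.

Lemma closed_subspace_perp E : closed_subspace (perp E).
Proof.
split=> [v _|a x y xE yE v Ev|x xE v Ev]; first exact: ip0l.
  by rewrite ipDl ipZl xE // yE // mulr0 addr0.
apply: rip_all_eq0 => a; apply/eqP; rewrite -normr_le0; apply/ler_addgt0Pr => e e0.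
rewrite add0r.
have n1 : 0 < rnorm (a *: v) + 1 by rewrite ltr_wpDl ?rnorm_ge0.
move/closure_rnormP: xE => /(_ (e / (rnorm (a *: v) + 1))).
move=> [|y Ey xy]; first by rewrite divr_gt0.
have y0 : rip y (a *: v) = 0 by rewrite /rip ipZr Ey // mulr0.
rewrite -(subr0 (rip _ _)) -[in _ - 0]y0 -ripBl.
apply: (le_trans (rip_le _ _)); move: xy; rewrite ltr_pdivlMr // => /ltW.
by apply: le_trans; rewrite ler_wpM2l ?rnorm_ge0 // lerDl.
Qed.

Lemma perp_self_eq0 E x : E x -> perp E x -> x = 0.
Proof. by move=> Ex /(_ _ Ex)/ip_eq0. Qed.

(** A sequence minimising the squared distance is Cauchy by the parallelogram law; its limit stays
    in the closed set [M] and attains the infimum. *)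
Lemma closest_point M x : closed_subspace M ->
  exists2 m, M m & forall y, M y -> rnorm (x - m) <= rnorm (x - y).
Proof.
move=> [M0 ML Mcl]; pose D : set R := [set rnorm (x - y) ^+ 2 | y in M].
have hD : has_inf D.
  split; first by exists (rnorm (x - 0) ^+ 2), 0.
  by exists 0 => _ [y _ <-]; exact: sqr_ge0.
pose d := inf D.
have dle y : M y -> d <= rnorm (x - y) ^+ 2.
  by move=> My; apply: inf_lbound; [case: hD | exists y].
have u_ (n : nat) : exists y, M y /\ rnorm (x - y) ^+ 2 < d + n.+1%:R^-1.
  have [|_ [y My <-] yd] := @inf_adherent _ D n.+1%:R^-1 _ hD.
    by rewrite invr_gt0.
  by exists y.
pose u n := projT1 (cid (u_ n)).
have uP n : M (u n) /\ rnorm (x - u n) ^+ 2 < d + n.+1%:R^-1 by rewrite /u; case: cid.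
have Mhalf y z : M y -> M z -> M ((2^-1 : R)%:C%C *: (y + z)).
  move=> My Mz; rewrite -[_ *: _]addr0; apply: (ML) => //.
  by rewrite -[y]scale1r; apply: ML.
(* the midpoint of two almost minimizers is no closer to [x] *)
have close m n : rnorm (u m - u n) ^+ 2 <= 2 * (m.+1%:R^-1 + n.+1%:R^-1).
  have := parallelogram (x - u n) (x - u m).
  have -> : x - u n - (x - u m) = u m - u n by rewrite opprB addrC addrA subrK.
  have -> : x - u n + (x - u m) =
      (2 : R)%:C%C *: (x - (2^-1 : R)%:C%C *: (u m + u n)).
    rewrite scalerBr scalerA -rmorphM /= divff // scale1r.
    by rewrite rmorphMn /= scaler_nat mulr2n [u m + u n]addrC opprD addrACA.
  rewrite -rip_sqr ripZl ripZr rip_sqr.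
  have := dle _ (Mhalf _ _ (uP m).1 (uP n).1).
  have := (uP m).2; have := (uP n).2.
  by move: (m.+1%:R^-1 : R) (n.+1%:R^-1 : R) => ? ?; lra.
have [|p up] := @rnorm_complete _ _ u.
  move=> e e0; have [|N inv_lt] := @natSinv_lt _ (e ^+ 2 / 4).
    by rewrite divr_gt0 ?exprn_gt0.
  exists N => m n Nm Nn.
  rewrite -(@ltr_pXn2r _ 2) ?nnegrE ?rnorm_ge0 ?(ltW e0) //.
  apply: (le_lt_trans (close m n)).
  have := inv_lt m Nm; have := inv_lt n Nn.
  by move: (m.+1%:R^-1 : R) (n.+1%:R^-1 : R) => ? ?; lra.
exists p.
  apply: Mcl; apply/closure_rnormP => e /up[N uN].
  by exists (u N); [case: (uP N) | apply: uN].
move=> y /dle dy.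
suff pd : rnorm (x - p) ^+ 2 <= d.
  by rewrite -(@ler_pXn2r _ 2) ?nnegrE ?rnorm_ge0 // (le_trans pd).
apply/ler_addgt0Pr => e e0.
have d0 : 0 <= d by apply: lb_le_inf; [case: hD | move=> _ [z _ <-]; exact: sqr_ge0].
(* The gap [s' - s] is the room left for the distance from [u N] to [p] when the triangle inequality
   is applied to unsquared norms. *)
set s := Num.sqrt (d + e / 2); set s' := Num.sqrt (d + e).
have ss' : s < s' by rewrite ltr_sqrt; lra.
have [N1 uN1] := up (s' - s) ltac:(lra).
have [|N2 inv_lt] := @natSinv_lt _ (e / 2); first by rewrite divr_gt0.
pose N := maxn N1 N2.
have pu : rnorm (p - u N) < s' - s by apply: uN1; exact: leq_maxl.
have us : rnorm (x - u N) < s.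
  rewrite -(@ltr_pXn2r _ 2) ?nnegrE ?rnorm_ge0 ?sqrtr_ge0 // sqr_sqrtr; last by lra.
  by apply: (lt_trans (uP N).2); rewrite ltrD2l inv_lt // leq_maxr.
have ps : rnorm (x - p) <= s' by have := ler_rdistD (u N) x p; rewrite (rdistC (u N)); lra.
rewrite -[leRHS]sqr_sqrtr; last by lra.
by rewrite ler_pXn2r ?nnegrE ?rnorm_ge0 ?sqrtr_ge0.
Qed.

Lemma orth_projection M x : closed_subspace M ->
  exists2 m, M m & perp M (x - m).
Proof.
move=> Msub; have [m Mm mP] := closest_point x Msub; exists m => // y My.
have [M0 ML _] := Msub.
apply: rip_all_eq0 => a; set v := a *: y.
have Mv : M v by rewrite -[v]addr0; apply: ML.
have [->|v0] := eqVneq v 0; first by rewrite ripC rip0l.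
have n0 : 0 < rnorm v ^+ 2 by rewrite exprn_gt0 ?rnorm_gt0.
(* Moving [m] by [t v] lowers the squared distance by exactly [rip (x - m) v ^+ 2 / rnorm v ^+ 2],
   which minimality forces to be zero. *)
set t := rip (x - m) v / rnorm v ^+ 2.
have := mP _ (ML t%:C%C v m Mv Mm).
rewrite -(@ler_pXn2r _ 2) ?nnegrE ?rnorm_ge0 //.
rewrite [_ *: v + m]addrC opprD addrA (rnorm_sqrB (x - m)).
rewrite -(rip_sqr (_ *: v)) ripZl !ripZr rip_sqr.
have -> : rnorm (x - m) ^+ 2 - 2 * (t * rip (x - m) v) + t * (t * rnorm v ^+ 2)
   = rnorm (x - m) ^+ 2 - rip (x - m) v ^+ 2 / rnorm v ^+ 2.
  by rewrite /t; field; rewrite gt_eqF ?rnorm_gt0.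
rewrite lerBrDl gerDr pmulr_lle0 ?invr_gt0 // => sq.
by apply/eqP; rewrite -sqrf_eq0 eq_le sq sqr_ge0.
Qed.

End InnerProduct.

(** * Joint eigenvectors *)

Lemma linear_op0 (R : realType) (H : completeNormedModType R[i])
  (T : H -> H) : linear_op T -> T 0 = 0.
Proof.
by move=> /(_ 1 0 0); rewrite !scale1r addr0 -[LHS]addr0 => /addrI.
Qed.

Lemma linear_op_scale (R : realType) (H : completeNormedModType R[i])
  (T : H -> H) (Tlin : linear_op T) (a : R[i]) (x : H) : T (a *: x) = a *: T x.
Proof. by rewrite -[a *: x]addr0 Tlin linear_op0 // addr0. Qed.

Section JointEigenvectors.
Context {R : realType} {H : completeNormedModType R[i]} {I : choiceType}.
Variables (ip : H -> H -> R[i]) (A Ast : I -> H -> H).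
Hypothesis ipP : inner_product ip.
Hypothesis Alin : forall i, linear_op (A i).
Hypothesis Aadj : forall i, is_adjoint ip (A i) (Ast i).
Hypothesis Acomm : forall i j x, A i (A j x) = A j (A i x).
Hypothesis Asum : forall x : H,
  fin_partial_sum (fun i => Ast i (A i x)) @ fin_subsets_net --> x.

(** The set contains 0 and is in general not a subspace, since [lam] depends on [v]; its double
    orthogonal complement is its closed span. *)
Definition joint_eigenvectors : set H :=
  [set v | exists lam : I -> R[i], forall i, A i v = lam i *: v].

Lemma fin_partial_sum_near (f : I -> H) (x : H) :
  fin_partial_sum f @ fin_subsets_net --> x ->
  forall e : R, 0 < e -> exists B0 : {fset I}, forall B, (B0 `<=` B)%fset ->
    rnorm (fin_partial_sum f B - x) < e.
Proof.
move=> fx e e0; have /fx[B0 _ B0P] : nbhs x [set y | rnorm (x - y) < e].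
  by apply/nbhs_rnormP; exists e.
by exists B0 => B /B0P; rewrite /= rdistC.
Qed.

Let Y i x := Ast i (A i x).

(** In the cross term [Ast j] crosses over as [A j], commutes past [A i], and [lam i *: v] becomes
    [A i v] again. In the last term the factor [rnorm v ^+ 2] lets [lam i] be absorbed in the same
    way. The result is additive in [Y i w] and [Y i v], hence can be summed over [i]. *)
Lemma adj_eigen_term (lam : I -> R[i]) (v : H) (i j : I) :
  A i v = lam i *: v ->
  let w := Ast j v in
  rnorm v ^+ 2 * rnorm (A i w - lam i *: w) ^+ 2 =
  rnorm v ^+ 2 * rip ip (Y i w) w - 2 * rnorm v ^+ 2 * rip ip (Y i v) (A j w)
  + rnorm w ^+ 2 * rip ip (Y i v) v.
Proof.
move=> Av w.
have YE x y : rip ip (Y i x) y = rip ip (A i x) (A i y).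
  by rewrite (ripC ipP) /rip -Aadj -/(rip ip _ _) (ripC ipP).
have lw : rip ip (A i w) (lam i *: w) = rip ip (A i v) (A i (A j w)).
  by rewrite (ripC ipP (A i v)) /rip Av Acomm !(ipZr ipP) /w -Aadj.
have lv : rnorm v ^+ 2 * rnorm (lam i *: w) ^+ 2 =
    rnorm w ^+ 2 * rip ip (A i v) (A i v).
  by rewrite Av (rip_sqr ipP) !rnormZ; ring.
by rewrite !YE (rnorm_sqrB ipP) mulrDr lv lw (rip_sqr ipP (A i w)); ring.
Qed.

Lemma adj_eigen (lam : I -> R[i]) (v : H) (j : I) :
  (forall i, A i v = lam i *: v) -> forall i, A i (Ast j v) = lam i *: Ast j v.
Proof.
move=> Av i; set w := Ast j v.
have [v0|v0] := eqVneq v 0.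
  suff -> : w = 0 by rewrite linear_op0 ?scaler0.
  by apply: (ip_eq0 ipP); rewrite {2}/w -Aadj v0 (ip0r ipP).
apply/eqP; rewrite -subr_eq0; apply/eqP/rnorm0_eq0/eqP.
have n0 := rnorm_gt0 v0.
suff : rnorm v ^+ 2 * rnorm (A i w - lam i *: w) ^+ 2 <= 0.
  rewrite pmulr_rle0 ?exprn_gt0 // => le0.
  by rewrite -sqrf_eq0 eq_le le0 sqr_ge0.
(* [K] is the factor by which an error in the two partial sums is multiplied in the summed
   identity. *)
pose K := rnorm v ^+ 2 * rnorm w + 2 * rnorm v ^+ 2 * rnorm (A j w)
  + rnorm w ^+ 2 * rnorm v.
have K0 : 0 <= K by rewrite !addr_ge0 ?mulr_ge0 ?sqr_ge0 ?rnorm_ge0.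
apply/ler_addgt0Pr => e e0; rewrite add0r.
have d0 : 0 < e / (K + 1) by rewrite divr_gt0 ?ltr_wpDl.
have [B1 B1P] := fin_partial_sum_near (@Asum w) d0.
have [B2 B2P] := fin_partial_sum_near (@Asum v) d0.
(* Adding [i] to the index set makes the term under study one of the nonnegative summands, so the
   whole finite sum bounds it. *)
pose B := ((B1 `|` B2) `|` [fset i])%fset.
have iB : i \in B by rewrite !inE eqxx orbT.
have /ltW dw : rnorm (fin_partial_sum (Y^~ w) B - w) < e / (K + 1).
  by apply: B1P; rewrite /B -fsetUA fsubsetUl.
have /ltW dv : rnorm (fin_partial_sum (Y^~ v) B - v) < e / (K + 1).
  by apply: B2P; rewrite /B fsetUAC fsubsetUr.
move: dw dv; set yw := fin_partial_sum _ B; set yv := fin_partial_sum _ B => dw dv.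
have : rnorm v ^+ 2 * rnorm (A i w - lam i *: w) ^+ 2 <=
  rnorm v ^+ 2 * rip ip yw w - 2 * rnorm v ^+ 2 * rip ip yv (A j w)
  + rnorm w ^+ 2 * rip ip yv v.
  rewrite !(rip_suml ipP) !mulr_sumr -sumrB -big_split /=.
  under eq_bigr => k _ do rewrite -(adj_eigen_term j (Av (val k))).
  rewrite (bigD1 [` iB]%fset) //= lerDl sumr_ge0 // => k _.
  by rewrite mulr_ge0 ?sqr_ge0.
move=> /le_trans; apply.
(* Replacing each partial sum by its limit plus an error, the limits cancel and only errors of total
   size at most [e] remain. *)
have -> : rip ip yw w = rip ip (yw - w) w + rnorm w ^+ 2.
  by rewrite (ripBl ipP) (rip_sqr ipP) subrK.
have -> : rip ip yv v = rip ip (yv - v) v + rnorm v ^+ 2.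
  by rewrite (ripBl ipP) (rip_sqr ipP) subrK.
have -> : rip ip yv (A j w) = rip ip (yv - v) (A j w) + rnorm w ^+ 2.
  have <- : rip ip (A j w) v = rnorm w ^+ 2 by rewrite -(rip_sqr ipP) /rip Aadj.
  by rewrite (ripBl ipP) (ripC ipP v) subrK.
have bnd z x : rnorm z <= e / (K + 1) -> `|rip ip z x| <= e / (K + 1) * rnorm x.
  by move=> zd; rewrite (le_trans (rip_le ipP _ _)) // ler_wpM2r ?rnorm_ge0.
have KE : e / (K + 1) * K <= e.
  by rewrite mulrAC ler_pdivrMr ?ltr_wpDl // ler_pM2l // lerDl.
move: (bnd _ w dw) (bnd _ (A j w) dv) (bnd _ v dv) KE => {bnd}.
rewrite !ler_norml /K; set d := e / _.
move=> /andP[_ b1] /andP[b2 _] /andP[_ b3].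
have := ler_wpM2l (sqr_ge0 (rnorm v)) b1.
have := ler_wpM2l (sqr_ge0 (rnorm v)) b2.
have := ler_wpM2l (sqr_ge0 (rnorm w)) b3.
lra.
Qed.

Lemma joint_eigenvectors_adj (j : I) (v : H) :
  joint_eigenvectors v -> joint_eigenvectors (Ast j v).
Proof. by move=> [lam Av]; exists lam; exact: adj_eigen. Qed.

Lemma joint_eigenvectors_normal (j : I) (v : H) :
  joint_eigenvectors v -> A j (Ast j v) = Ast j (A j v).
Proof.
move=> [lam Av]; rewrite (adj_eigen _ Av) Av.
(* Linearity of [Ast j] is not among the hypotheses; homogeneity is read off the adjoint relation by
   testing against every [x]. *)
have orth x : ip x (lam j *: Ast j v - Ast j (lam j *: v)) = 0.
  by rewrite (ipBr ipP) (ipZr ipP) -!Aadj (ipZr ipP) subrr.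
by have /eqP := ip_eq0 ipP (orth _); rewrite subr_eq0 => /eqP.
Qed.

Lemma perp_invariant (j : I) : invariant_under (A j) (perp ip joint_eigenvectors).
Proof. by move=> x xE v Ev; rewrite Aadj; exact/xE/joint_eigenvectors_adj. Qed.

Lemma perp_invariant_adj (j : I) :
  invariant_under (Ast j) (perp ip joint_eigenvectors).
Proof.
move=> x xE v [lam Av].
apply: (ip_eq0C ipP); rewrite -Aadj Av (ipZl ipP) (ip_eq0C ipP) ?mulr0 //.
by apply: xE; exists lam.
Qed.

Lemma perp_perp_invariant (j : I) :
  invariant_under (A j) (perp ip (perp ip joint_eigenvectors)).
Proof. by move=> x xE v Ev; rewrite Aadj; exact/xE/perp_invariant_adj. Qed.

Lemma perp_perp_invariant_adj (j : I) :
  invariant_under (Ast j) (perp ip (perp ip joint_eigenvectors)).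
Proof.
move=> x xE v Ev; apply: (ip_eq0C ipP); rewrite -Aadj.
by apply: (ip_eq0C ipP); exact/xE/perp_invariant.
Qed.

(** The commutator applied to [x] stays in the double complement by invariance. It is also
    orthogonal to every joint eigenvector, because the commutator can be moved onto that vector,
    where it vanishes. So it is orthogonal to itself. *)
Lemma perp_perp_normal (j : I) :
  normal_on ip (perp ip (perp ip joint_eigenvectors)) (A j).
Proof.
exists (Ast j); split=> [|x y _ _|x xE]; first exact: perp_perp_invariant_adj.
  exact: Aadj.
set z := A j (Ast j x) - Ast j (A j x).
suff : z = 0 by move/eqP; rewrite subr_eq0 => /eqP.
apply: (perp_self_eq0 ipP (E := perp ip joint_eigenvectors)).
  move=> v Ev; rewrite (ipBl ipP) Aadj; apply/eqP; rewrite subr_eq0; apply/eqP.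
  (* Conjugating swaps the arguments and puts [Ast j] in the second slot, where the adjoint relation
     applies. *)
  apply: (can_inj (@conjcK _)).
  rewrite -(ipC ipP) -(ipC ipP) -!Aadj joint_eigenvectors_normal //.
  by rewrite [LHS](ipC ipP) -Aadj -(ipC ipP).
have xE1 := perp_perp_invariant j (perp_perp_invariant_adj j xE).
have xE2 := perp_perp_invariant_adj j (perp_perp_invariant j xE).
by move=> y yE; rewrite (ipBl ipP) xE1 // xE2 // subrr.
Qed.

End JointEigenvectors.

(** * Riesz theory of compact operators *)

Section LinearOperators.
Context {R : realType} {H : completeNormedModType R[i]}.
Implicit Types (T : H -> H) (M : set H).

Lemma linear_opB T x y : linear_op T -> T (x - y) = T x - T y.
Proof.
by move=> Tlin; rewrite addrC -scaleN1r Tlin scaleN1r addrC.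
Qed.

Lemma linear_op_sub T (l : R[i]) :
  linear_op T -> linear_op (fun x => T x - l *: x).
Proof.
move=> Tlin a x y; rewrite Tlin scalerDr scalerBr !scalerA (mulrC l).
by rewrite opprD addrACA.
Qed.

Lemma closed_subspaceZ M a x : closed_subspace M -> M x -> M (a *: x).
Proof. by move=> [M0 ML _] Mx; rewrite -[_ *: _]addr0; exact: ML. Qed.

Lemma closed_subspaceB M x y : closed_subspace M -> M x -> M y -> M (x - y).
Proof. by move=> [_ ML _] Mx My; rewrite addrC -scaleN1r; exact: ML. Qed.

Lemma closed_subspaceI M N : closed_subspace M -> closed_subspace N ->
  closed_subspace (M `&` N).
Proof.
move=> [M0 ML Mcl] [N0 NL Ncl]; split => //; last exact: closedI.
by move=> a x y [Mx Nx] [My Ny]; split; [exact: ML | exact: NL].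
Qed.

Lemma compact_op_bounded T : compact_op T ->
  exists2 C : R, 0 <= C & forall x, rnorm (T x) <= C * rnorm x.
Proof.
move=> [Tlin /compact_rnorm_bounded[C C0 CP]]; exists C => // x.
have [->|x0] := eqVneq x 0.
  by rewrite linear_op0 // rnorm0 mulr0.
have n0 := rnorm_gt0 x0.
have xE : x = (rnorm x)%:C%C *: ((rnorm x)^-1%:C%C *: x).
  by rewrite scalerA -rmorphM /= mulfV ?gt_eqF // scale1r.
rewrite {1}xE (linear_op_scale Tlin) rnormZ_real ?rnorm_ge0 // mulrC.
rewrite ler_wpM2r ?rnorm_ge0 //.
apply: CP; apply: subset_closure; exists ((rnorm x)^-1%:C%C *: x) => //=.
by rewrite norm_rnormE rnormZV.
Qed.

Lemma compact_op_not_separated T (u : nat -> H) (d : R) :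
  compact_op T -> (forall n, rnorm (u n) <= 1) -> 0 < d ->
  ~ (forall m n : nat, (m < n)%N -> d <= rnorm (T (u m) - T (u n))).
Proof.
move=> [_ cT] u1; apply: (compact_not_separated cT) => n.
by apply: subset_closure; exists (u n) => //=;
  rewrite norm_rnormE -(rmorph1 (real_complex R)) lecR.
Qed.

Lemma closed_eigenspace T (l : R[i]) : compact_op T ->
  closed_subspace [set x | T x = l *: x].
Proof.
move=> cT; have [C C0 CP] := compact_op_bounded cT; have Tlin := cT.1.
split=> [|a x y /= Tx Ty|x xT /=].
- by rewrite /= linear_op0 ?scaler0.
- by rewrite Tlin Tx Ty scalerDr !scalerA mulrC.
apply/eqP; rewrite -subr_eq0; apply/eqP/rnorm0_eq0/eqP; rewrite eq_le rnorm_ge0 andbT.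
apply/ler_addgt0Pr => e e0; rewrite add0r.
set L := complex.Re `|l|; have L0 : 0 <= L by exact: Re_normc_ge0.
have K0 : 0 < C + L + 1 by rewrite ltr_wpDl ?addr_ge0.
move/closure_rnormP: xT => /(_ (e / (C + L + 1))) [|y /= Ty xy].
  by rewrite divr_gt0.
(* The nearby eigenvector [y] may be subtracted for free, and [T - l] is bounded by [C + L]. *)
have -> : T x - l *: x = T (x - y) - l *: (x - y).
  by rewrite linear_opB // Ty scalerBr opprB addrA subrK.
apply: (le_trans (ler_rnormD _ _)); rewrite rnormN rnormZ -/L.
apply: (le_trans (lerD (CP _) (lexx _))); rewrite -mulrDl.
move: xy; rewrite ltr_pdivlMr // mulrDr mulr1 mulrC; have := rnorm_ge0 (x - y).
lra.
Qed.

End LinearOperators.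

Section RieszTheory.
Context {R : realType} {H : completeNormedModType R[i]}.
Variable ip : H -> H -> R[i].
Hypothesis ipP : inner_product ip.
Variables (T : H -> H) (l : R[i]).
Hypotheses (cT : compact_op T) (l0 : l != 0).

Let Tlin : linear_op T. Proof. by case: cT. Qed.
Let S x := T x - l *: x.
Let Slin : linear_op S. Proof. exact: linear_op_sub. Qed.

Lemma rnorm_le_orth x y : ip x y = 0 -> rnorm x <= rnorm (x + y).
Proof.
move=> xy; rewrite -(@ler_pXn2r _ 2) ?nnegrE ?rnorm_ge0 // (rnorm_sqrD ipP).
by rewrite /rip xy mulr0 addr0 lerDl sqr_ge0.
Qed.

(** The vector is a normalised difference between a point of [M] outside [N] and its projection on
    [N]; projections give exact orthogonality in place of the almost orthogonal vectors of a general
    Banach space. *)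
Lemma riesz_unit_vector (M N : set H) : closed_subspace M -> closed_subspace N ->
  N `<=` M -> ~ (M `<=` N) -> exists x, [/\ M x, rnorm x = 1 & perp ip N x].
Proof.
move=> Msub Nsub NM /existsNP[y /not_implyP[My nNy]].
have [m Nm mP] := orth_projection ipP y Nsub.
have z0 : y - m != 0.
  by apply: contra_notN nNy => /eqP/subr0_eq ->.
have n0 := rnorm_gt0 z0.
exists ((rnorm (y - m))^-1%:C%C *: (y - m)); split.
- by apply: closed_subspaceZ => //; apply: closed_subspaceB => //; exact: NM.
- exact: rnormZV.
- by move=> v Nv; rewrite (ipZl ipP) mP // mulr0.
Qed.

(* F. Riesz: unit vectors [x k] of [N k] orthogonal to [N k.+1] would have
   images under [T] at mutual distance at least [|l|]. *)
Lemma no_strict_chain (N : nat -> set H) :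
  (forall k, closed_subspace (N k)) -> (forall k, N k.+1 `<=` N k) ->
  (forall k, invariant_under T (N k)) ->
  (forall k x, N k x -> N k.+1 (T x - l *: x)) ->
  exists k, N k `<=` N k.+1.
Proof.
move=> Nsub Ndec NT NS; apply: contrapT => nex.
have x_ k : exists x, [/\ N k x, rnorm x = 1 & perp ip (N k.+1) x].
  by apply: riesz_unit_vector => // NN; apply: nex; exists k.
pose x k := projT1 (cid (x_ k)).
have xP k : [/\ N k (x k), rnorm (x k) = 1 & perp ip (N k.+1) (x k)].
  by rewrite /x; case: cid.
have Nle m n : (m <= n)%N -> N n `<=` N m.
  elim: n => [|n IHn]; first by rewrite leqn0 => /eqP ->.
  rewrite leq_eqVlt => /predU1P[-> //|]; rewrite ltnS => /IHn; apply: subset_trans.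
  exact: Ndec.
apply: (@compact_op_not_separated _ _ T x (complex.Re `|l|) cT).
- by move=> n; have [_ ->] := xP n.
- exact: Re_normc_gt0.
move=> m n mn; have [Nm xm1 xmP] := xP m; have [Nn _ _] := xP n.
(* The bracket lies in [N m.+1], to which [x m] is orthogonal, so it cannot shorten [l *: x m]. *)
have -> : T (x m) - T (x n) = l *: x m + (S (x m) - T (x n)).
  by rewrite /S addrA [l *: _ + _]addrC subrK.
have <- : rnorm (l *: x m) = complex.Re `|l| by rewrite rnormZ xm1 mulr1.
apply: rnorm_le_orth; rewrite (ipZl ipP) xmP ?mulr0 //.
apply: closed_subspaceB => //; first exact: NS.
exact/NT/(Nle _ _ mn).
Qed.

(** * Invertibility of [T - l] on a closed invariant subspace where it is injective *)

Section OnSubspace.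
Variable M : set H.
Hypotheses (Msub : closed_subspace M) (MT : invariant_under T M).
Hypothesis Minj : forall x, M x -> T x = l *: x -> x = 0.

(** Otherwise there are unit vectors [x n] in [M] with [S (x n)] tending to 0. A cluster point [p]
    of [T (x n)] is then one of [l *: x n] too, so it lies in [M] and satisfies [T p = l *: p].
    Injectivity gives [p = 0], although every [l *: x n] has norm [L > 0]. *)
Lemma bounded_below :
  exists2 c : R, 0 < c & forall x, M x -> c * rnorm x <= rnorm (T x - l *: x).
Proof.
apply: contrapT => nex.
have x_ (n : nat) : exists x, [/\ M x, rnorm x = 1 & rnorm (S x) < n.+1%:R^-1].
  apply: contrapT => nx; apply: nex; exists n.+1%:R^-1; first by rewrite invr_gt0.
  move=> x Mx; rewrite leNgt; apply/negP => Sx; apply: nx.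
  have x0 : x != 0.
    apply: contraTneq Sx => ->; rewrite rnorm0 mulr0 -leNgt; exact: rnorm_ge0.
  have n0 := rnorm_gt0 x0.
  exists ((rnorm x)^-1%:C%C *: x); split; first exact: closed_subspaceZ.
    exact: rnormZV.
  rewrite (linear_op_scale Slin) rnormZ_real ?invr_ge0 ?rnorm_ge0 //.
  by rewrite mulrC ltr_pdivrMr.
pose x n := projT1 (cid (x_ n)).
have xP n : [/\ M (x n), rnorm (x n) = 1 & rnorm (S (x n)) < n.+1%:R^-1].
  by rewrite /x; case: cid.
have [|p pP] := compact_cluster_seq cT.2 (u := fun n => T (x n)).
  move=> n; apply: subset_closure; exists (x n) => //=.
  by rewrite norm_rnormE; have [_ -> _] := xP n.
pose L := complex.Re `|l|; have L0 : 0 < L by exact: Re_normc_gt0.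
have near_p (e : R) : 0 < e ->
    exists2 n, rnorm (p - l *: x n) < e & rnorm (S (x n)) < e.
  move=> e0; have [N NP] := natSinv_lt (e := e / 2) ltac:(lra).
  have [n Nn np] := pP (e / 2) ltac:(lra) N.
  have [_ _ Sx] := xP n; have nN := NP n Nn.
  exists n; last by move: Sx nN; move: (n.+1%:R^-1 : R) => ?; lra.
  move: Sx nN; have := ler_rdistD (T (x n)) p (l *: x n); rewrite (rdistC p (T (x n))) /S.
  by move: (n.+1%:R^-1 : R) => ?; lra.
have Mp : M p.
  have [_ _ Mcl] := Msub; apply: Mcl; apply/closure_rnormP => e /near_p[n pn _].
  by exists (l *: x n) => //; apply: closed_subspaceZ => //; have [] := xP n.
have [C C0 CP] := compact_op_bounded cT.
have p0 : p = 0.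
  apply: Minj => //; apply/eqP; rewrite -subr_eq0; apply/eqP/rnorm0_eq0/eqP.
  rewrite eq_le rnorm_ge0 andbT; apply/ler_addgt0Pr => e e0; rewrite add0r.
  (* [T - l] contributes [C + L] on [p - l *: x n], and [l *: S (x n)] contributes a further [L]. *)
  have K0 : 0 < C + 2 * L + 1 by lra.
  have [|n pn Sn] := near_p (e / (C + 2 * L + 1)); first by rewrite divr_gt0.
  have -> : T p - l *: p = (T (p - l *: x n) - l *: (p - l *: x n)) + l *: S (x n).
    rewrite linear_opB // (linear_op_scale Tlin) /S !scalerBr.
    by rewrite [RHS]addrAC addrA subrK opprB addrA subrK.
  set y := p - _ in pn *; set z := S _ in Sn *.
  have := ler_rnormD (T y - l *: y) (l *: z).
  have := ler_rnormD (T y) (- (l *: y)); rewrite rnormN !rnormZ -/L.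
  have := CP y; set d := e / _ in pn Sn.
  have <- : d * (C + 2 * L + 1) = e by rewrite /d divfK ?gt_eqF.
  have := ler_wpM2l C0 (ltW pn); have := ler_wpM2l (ltW L0) (ltW pn).
  have := ler_wpM2l (ltW L0) (ltW Sn).
  have : 0 < d by rewrite /d divr_gt0.
  lra.
have [n + _] := near_p L L0; rewrite p0 sub0r rnormN rnormZ.
by have [_ -> _] := xP n; rewrite mulr1 ltxx.
Qed.

(** By [bounded_below], preimages of a convergent sequence of images form a Cauchy sequence; their
    limit lies in [N] and is sent to the limit of the images. *)
Lemma closed_subspace_image (N : set H) : closed_subspace N -> N `<=` M ->
  closed_subspace ((fun x => T x - l *: x) @` N).
Proof.
move=> Nsub NM; have [N0 NL Ncl] := Nsub; split.
- by exists 0 => //; rewrite linear_op0 // scaler0 subr0.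
- move=> a _ _ [x Nx <-] [y Ny <-]; exists (a *: x + y); first exact: NL.
  exact: Slin.
move=> y yN; have [c c0 cP] := bounded_below.
have [C C0 CP] := compact_op_bounded cT.
have x_ (n : nat) : exists x, N x /\ rnorm (y - S x) < n.+1%:R^-1.
  move/closure_rnormP: yN => /(_ n.+1%:R^-1)[|_ [x Nx <-] xy]; first by rewrite invr_gt0.
  by exists x.
pose x n := projT1 (cid (x_ n)).
have xP n : N (x n) /\ rnorm (y - S (x n)) < n.+1%:R^-1 by rewrite /x; case: cid.
have [|p pP] := @rnorm_complete _ _ x.
  move=> e e0; have [|k kP] := @natSinv_lt _ (c * e / 2).
    by rewrite divr_gt0 ?mulr_gt0.
  exists k => m n km kn; rewrite -(ltr_pM2l c0).
  have Mmn : M (x m - x n)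
    by apply/NM/(closed_subspaceB Nsub); [exact: (xP m).1 | exact: (xP n).1].
  apply: (le_lt_trans (cP _ Mmn)); rewrite -/(S _) linear_opB //.
  have := ler_rdistD y (S (x m)) (S (x n)); rewrite (rdistC _ y).
  have := (xP m).2; have := (xP n).2; have := kP m km; have := kP n kn.
  by move: (m.+1%:R^-1 : R) (n.+1%:R^-1 : R) => ? ?; lra.
exists p.
  apply: Ncl; apply/closure_rnormP => e /pP[k kP].
  by exists (x k); [exact: (xP k).1 | exact: kP].
apply/eqP; rewrite -subr_eq0; apply/eqP/rnorm0_eq0/eqP.
rewrite eq_le rnorm_ge0 andbT; apply/ler_addgt0Pr => e e0; rewrite add0r.
pose L := complex.Re `|l|; have L0 : 0 < L by exact: Re_normc_gt0.
have K0 : 0 < 2 * (C + L) by lra.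
have [|k1 k1P] := pP (e / (2 * (C + L))); first by rewrite divr_gt0.
have [|k2 k2P] := @natSinv_lt _ (e / 2); first by rewrite divr_gt0.
pose n := maxn k1 k2; have pn := k1P n (leq_maxl _ _).
have nn := k2P n (leq_maxr _ _); have yn := (xP n).2.
have := ler_rdistD (S (x n)) (S p) y; rewrite (rdistC (S (x n)) y) -(linear_opB _ _ Slin).
have := ler_rnormD (T (p - x n)) (- (l *: (p - x n))).
rewrite rnormN rnormZ -/L -/(S (p - x n)) -/(S p).
have := CP (p - x n); move: pn; rewrite ltr_pdivlMr //.
by move: nn yn; move: (n.+1%:R^-1 : R) => ?; lra.
Qed.

Lemma sub_eigen_inj x y : M x -> M y -> T x - l *: x = T y - l *: y -> x = y.
Proof.
move=> Mx My Sxy; apply/eqP; rewrite -subr_eq0; apply/eqP/Minj.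
  exact: closed_subspaceB.
apply/eqP; rewrite -subr_eq0; change (S (x - y) == 0).
by rewrite (linear_opB _ _ Slin) subr_eq0; apply/eqP.
Qed.

(** The iterated images of [M] under [S] form a decreasing chain of closed invariant subspaces,
    which must stop decreasing at some stage. *)
Lemma sub_eigen_surjective y : M y -> exists2 x, M x & T x - l *: x = y.
Proof.
move=> My; pose N k := iter k (fun N' : set H => S @` N') M.
have NP k : [/\ closed_subspace (N k), N k `<=` M & invariant_under T (N k)].
  elim: k => [|k [Nsub NM NT]]; first by split.
  split; first exact: closed_subspace_image.
    move=> _ [x /NM Mx <-]; apply: closed_subspaceB => //; first exact: MT.
    exact: closed_subspaceZ.
  move=> _ [x Nx <-]; exists (T x); first exact: NT.
  by rewrite /S linear_opB // (linear_op_scale Tlin).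
have SN k x : N k x -> N k.+1 (T x - l *: x) by exists x.
have Ndec k : N k.+1 `<=` N k.
  move=> _ [x Nx <-]; have [Nsub NM NT] := NP k.
  by apply: closed_subspaceB => //; [exact: NT | exact: closed_subspaceZ].
have [k Nk] : exists k, N k `<=` N k.+1.
  by apply: no_strict_chain => // k; have [] := NP k.
(* Injectivity cancels one application of [S], bringing the stationary stage down to 0, where it
   says that [S] maps [M] onto [M]. *)
elim: k Nk => [|k IHk] Nk; first by have [x Mx] := Nk y My; exists x.
apply: IHk => x Nx; have [x' Nx' Sx] := Nk _ (SN _ _ Nx).
have [_ NM _] := NP k; have [_ NM' _] := NP k.+1.
by rewrite -(sub_eigen_inj _ _ Sx) //; [exact: NM' | exact: NM].
Qed.

Lemma fredholm_alternative : invertible_on M (fun x => T x - l *: x).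
Proof.
have [c c0 cP] := bounded_below.
have B_ y : exists x, M y -> M x /\ S x = y.
  have [/sub_eigen_surjective[x Mx Sx]|nMy] := pselect (M y); first by exists x.
  (* Outside [M] the requirement is vacuous and any value serves. *)
  by exists 0.
pose B y := projT1 (cid (B_ y)).
have BP y : M y -> M (B y) /\ S (B y) = y by rewrite /B; case: cid.
exists B; split=> [y /BP[] //||x Mx|y /BP[] //].
  exists c^-1%:C%C => y /BP[MB SB]; rewrite !norm_rnormE -rmorphM /= lecR.
  by rewrite mulrC ler_pdivlMr // mulrC (le_trans (cP _ MB)) // -/(S _) SB.
have MS : M (S x) by apply: closed_subspaceB => //; [exact: MT|exact: closed_subspaceZ].
have [MB SB] := BP _ MS.
exact: sub_eigen_inj.
Qed.

End OnSubspace.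
End RieszTheory.

(** * Joint eigenvectors in an eigenspace of a compact operator *)

Section Eigenvectors.
Context {R : realType} {H : completeNormedModType R[i]}.
Variable ip : H -> H -> R[i].
Hypothesis ipP : inner_product ip.

Section CompactEigenspace.
Variables (T : H -> H) (l : R[i]).
Hypotheses (cT : compact_op T) (l0 : l != 0).

(* This is how the finite dimension of the eigenspace is expressed: finitely
   many functionals [ip^~ y] separate its points. *)
Lemma eigenspace_separated (F : set H) :
  closed_subspace F -> (forall x, F x -> T x = l *: x) ->
  exists s : seq H, forall x, F x -> (forall y, y \in s -> ip x y = 0) -> x = 0.
Proof.
move=> Fsub FT; apply: contrapT => nex.
have u_ (s : seq H) : exists x, [/\ F x, forall y, y \in s -> ip x y = 0 & x <> 0].
  apply: contrapT => nx; apply: nex; exists s => x Fx xs.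
  by apply: contrapT => x0; apply: nx; exists x.
pose u s := projT1 (cid (u_ s)).
have uP s : [/\ F (u s), forall y, y \in s -> ip (u s) y = 0 & u s <> 0].
  by rewrite /u; case: cid.
(* Each [u (L k)] is a nonzero vector of [F] orthogonal to its predecessors. If the chain of
   complements [N k] stopped decreasing, some [u (L k)] would be orthogonal to itself. *)
pose L k := iter k (fun s => u s :: s) [::].
pose N k := F `&` perp ip [set y | y \in L k].
have Nsub k : closed_subspace (N k).
  by apply: closed_subspaceI => //; exact: closed_subspace_perp.
have [k Nk] : exists k, N k `<=` N k.+1.
  apply: (no_strict_chain ipP cT l0) => // k x [Fx xL].
  - by split => // y yL; apply: xL; rewrite /= inE yL orbT.
  - by rewrite FT //; apply: closed_subspaceZ.
  - by rewrite FT // subrr; have [] := Nsub k.+1.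
have [Fu uL u0] := uP (L k).
have [_ uu] := Nk _ (conj Fu uL).
by apply/u0/(ip_eq0 ipP)/uu; rewrite /= mem_head.
Qed.

(** Without a minimal member, repeated choice gives a strictly decreasing sequence of closed
    subspaces. [T] acts on them as the scalar [l], so [T - l] sends each into the next and
    [no_strict_chain] applies. This replaces a choice of least dimension. *)
Lemma eigenspace_minimal (Q : set H -> Prop) :
  (forall G, Q G -> closed_subspace G /\ forall x, G x -> T x = l *: x) ->
  (exists G, Q G) ->
  exists2 G, Q G & forall G', Q G' -> G' `<=` G -> G `<=` G'.
Proof.
move=> QP [G0 QG0]; apply: contrapT => nex.
have f_ (G : {G | Q G}) : exists G' : {G | Q G},
    sval G' `<=` sval G /\ ~ (sval G `<=` sval G').
  apply: contrapT => nG; apply: nex; exists (sval G); first exact: svalP.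
  move=> G' QG' G'G; apply: contrapT => GG'; apply: nG.
  by exists (exist _ G' QG').
pose f G := projT1 (cid (f_ G)).
have fP G : sval (f G) `<=` sval G /\ ~ (sval G `<=` sval (f G)).
  by rewrite /f; case: cid.
pose N k := sval (iter k f (exist _ G0 QG0)).
have NP k : closed_subspace (N k) /\ forall x, N k x -> T x = l *: x.
  exact/QP/svalP.
have [k Nk] : exists k, N k `<=` N k.+1.
  apply: (no_strict_chain ipP cT l0) => k; have [Nsub NT] := NP k => //.
  - exact: (fP _).1.
  - by move=> x Nx; rewrite NT //; apply: closed_subspaceZ.
  - by move=> x Nx; rewrite NT // subrr; have [[]] := NP k.+1.
by have [_] := fP (iter k f (exist _ G0 QG0)); apply.
Qed.

End CompactEigenspace.

(** * Eigenvectors from annihilating polynomials *)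

Section PolynomialRoot.
Variables (B : H -> H) (G : set H).
Hypotheses (Blin : linear_op B) (Gsub : closed_subspace G).
Hypothesis GB : invariant_under B G.

Lemma iter_linear k : linear_op (iter k B).
Proof. by elim: k => [|k IHk] a x y //=; rewrite IHk Blin. Qed.

Lemma poly_eval_mulXsub (q : {poly R[i]}) (r : R[i]) (N : nat) (x : H) :
  (size q <= N)%N ->
  \sum_(k < N.+1) (q * ('X - r%:P))`_k *: iter k B x =
  \sum_(k < N) q`_k *: iter k B (B x - r *: x).
Proof.
move=> qN; have Br k : iter k B (B x - r *: x) = iter k.+1 B x - r *: iter k B x.
  by rewrite (linear_opB _ _ (iter_linear k)) (linear_op_scale (iter_linear k)) iterSr.
under eq_bigr => k _ do rewrite mulrBr coefB coefMX coefMC scalerBl.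
under [RHS]eq_bigr => k _ do rewrite Br scalerBr scalerA.
rewrite !sumrB big_ord_recl /= scale0r add0r; congr (_ - _).
by rewrite big_ord_recr /= [q`_N]nth_default // mul0r scale0r addr0.
Qed.

(** Split off a complex root [r] of [p]: either [x] is an eigenvector for [r], or the quotient
    annihilates the nonzero vector [B x - r *: x] and induction on the size bound applies. A nonzero
    constant annihilates no nonzero vector, so [p] has a root. *)
Lemma poly_annihilator_eigenvector (N : nat) (p : {poly R[i]}) (x : H) :
  p != 0 -> (size p <= N.+1)%N -> G x -> x != 0 ->
  \sum_(k < N.+1) p`_k *: iter k B x = 0 ->
  exists2 y, G y & y != 0 /\ exists mu, B y = mu *: y.
Proof.
have const (m : nat) (q : {poly R[i]}) (y : H) : size q = 1%N -> y != 0 ->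
    \sum_(k < m.+1) q`_k *: iter k B y != 0.
  move=> q1 y0; rewrite big_ord_recl big1 ?addr0 => [|k _].
    rewrite scaler_eq0 (negPf y0) orbF.
    have : lead_coef q != 0 by rewrite lead_coef_eq0 -size_poly_eq0 q1.
    by rewrite lead_coefE q1.
  by rewrite nth_default ?scale0r // q1.
elim: N p x => [|N IHN] p x p0 pN Gx x0 px.
  have p1 : size p = 1%N by apply/eqP; rewrite eqn_leq pN lt0n size_poly_eq0.
  by have := const 0%N _ _ p1 x0; rewrite px eqxx.
have [p1|p1] := eqVneq (size p) 1%N.
  by have := const N.+1 _ _ p1 x0; rewrite px eqxx.
have [r /factor_theorem[q pE]] := closed_rootP p p1.
have q0 : q != 0 by apply: contraNneq p0 => q0; rewrite pE q0 mul0r.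
have qN : (size q <= N.+1)%N.
  by move: pN; rewrite pE size_Mmonic ?monicXsubC // size_XsubC addn2.
have [Bx|Bx] := eqVneq (B x - r *: x) 0.
  by exists x => //; split => //; exists r; apply/subr0_eq.
apply: (IHN q (B x - r *: x)) => //.
  by apply: closed_subspaceB => //; [exact: GB | exact: closed_subspaceZ].
by rewrite -poly_eval_mulXsub // -pE.
Qed.

(** With [n] functionals separating the points of [G], the [n + 1] vectors [iter k B x] are linearly
    dependent, and a dependence is a polynomial in [B] annihilating [x]. *)
Lemma separated_eigenvector (s : seq H) (x : H) :
  (forall y, G y -> (forall z, z \in s -> ip y z = 0) -> y = 0) ->
  G x -> x != 0 -> exists2 y, G y & y != 0 /\ exists mu, B y = mu *: y.
Proof.
move=> sP Gx x0; set n := size s.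
have GBk k : G (iter k B x) by elim: k => //= k; exact: GB.
pose D : 'M[R[i]]_(n.+1, n) := \matrix_(k, j) ip (iter k B x) s`_j.
have [v v0 vD] : exists2 v : 'rV_n.+1, v != 0 & v *m D = 0.
  (* [D] has [n + 1] rows and rank at most [n], so some nonzero row vector is in its left kernel. *)
  have /rowV0Pn[v vk v0] : kermx D != 0.
    rewrite kermx_eq0 -row_leq_rank -ltnNge; exact: (leq_ltn_trans (rank_leq_col D)).
  by exists v => //; apply/sub_kermxP.
pose p : {poly R[i]} := \poly_(k < n.+1) v 0 (inord k).
have pk (k : 'I_n.+1) : p`_k = v 0 k by rewrite coef_poly ltn_ord inord_val.
apply: (@poly_annihilator_eigenvector n p x) => //.
- apply: contra_neq v0 => p0; apply/rowP => k.
  by rewrite mxE -pk p0 coef0.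
- exact: size_poly.
apply: sP => [|z zs].
  have [G0 GL _] := Gsub; elim/big_ind: _ => // [y z Gy Gz|k _].
    by rewrite -[y]scale1r; apply: GL.
  exact: closed_subspaceZ.
rewrite (ip_suml ipP).
have js : (index z s < n)%N by rewrite index_mem.
move/matrixP: vD => /(_ 0 (Ordinal js)); rewrite !mxE; apply: etrans.
by apply: eq_bigr => k _; rewrite (ipZl ipP) pk mxE /= nth_index.
Qed.

End PolynomialRoot.

(** In a minimal nonzero closed invariant subspace [G] of [F], each [A i] has an eigenvector. The
    corresponding eigenspace within [G] is again invariant because the operators commute, so it is
    all of [G]. Hence each [A i] is scalar on [G], for an index set of any size. *)
Lemma joint_eigenvector_exists (I : Type) (A : I -> H -> H) (T : H -> H) (l : R[i])
  (F : set H) :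
  (forall i, compact_op (A i)) -> (forall i j x, A i (A j x) = A j (A i x)) ->
  compact_op T -> l != 0 ->
  closed_subspace F -> (forall x, F x -> T x = l *: x) ->
  (forall i, invariant_under (A i) F) -> (exists2 x, F x & x != 0) ->
  exists2 v, F v & v != 0 /\ exists lam : I -> R[i], forall i, A i v = lam i *: v.
Proof.
move=> cA Acomm cT l0 Fsub FT FA Fn0.
pose Q G := [/\ closed_subspace G, G `<=` F, forall i, invariant_under (A i) G
  & exists2 x, G x & x != 0].
have [|| G [Gsub GF GA [x Gx x0]] Gmin] := @eigenspace_minimal T l cT l0 Q.
- by move=> G [Gsub GF _ _]; split => // x /GF/FT.
- by exists F; split.
have [s sP] := eigenspace_separated cT l0 Fsub FT.
exists x; first exact: GF.
split => //; suff /choice[lam Ax] : forall i, exists m, A i x = m *: x by exists lam.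
move=> i.
have [|y Gy [y0 [mu Ay]]] :=
  @separated_eigenvector (A i) G (cA i).1 Gsub (GA i) s x _ Gx x0.
  by move=> y /GF; exact: sP.
exists mu; have Gmu : Q (G `&` [set z | A i z = mu *: z]).
  split.
  - by apply: closed_subspaceI => //; exact: closed_eigenspace.
  - by move=> z [/GF].
  - move=> j z [Gz Az]; split; first exact: GA.
    by rewrite /= Acomm Az (linear_op_scale (cA j).1).
  - by exists y.
by have [] := Gmin _ Gmu (fun z => @proj1 _ _) x Gx.
Qed.

End Eigenvectors.

(** * The orthogonal decomposition *)

Theorem theorem1p6 (R : realType) (H : completeNormedModType R[i])
  (ip : H -> H -> R[i]) (I : choiceType) (A Ast : I -> H -> H) :
  inner_product ip ->
  (forall i, compact_op (A i)) ->
  (forall i, is_adjoint ip (A i) (Ast i)) ->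
  (forall i j x, A i (A j x) = A j (A i x)) ->
  (forall x : H, fin_partial_sum (fun i => Ast i (A i x)) @ fin_subsets_net --> x) ->
  exists Hqn Hn : set H,
    [/\ closed_subspace Hqn /\ closed_subspace Hn, orth_decomp ip Hqn Hn,
        (forall i, invariant_under (A i) Hqn /\ invariant_under (A i) Hn),
        (forall i, normal_on ip Hn (A i))
      & (forall i, quasinilpotent_on Hqn (A i))].
Proof.
move=> ipP cA Aadj Acomm Asum; have Alin i : linear_op (A i) by case: (cA i).
pose E := joint_eigenvectors A.
have Esub : closed_subspace (perp ip E) by exact: closed_subspace_perp.
have Einv i : invariant_under (A i) (perp ip E) by exact: perp_invariant.
exists (perp ip E), (perp ip (perp ip E)); split.
- by split => //; exact: closed_subspace_perp.
- split=> [x y Ex Ey|z]; first exact/(ip_eq0C ipP)/Ey.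
  have [m Em zm] := orth_projection ipP z Esub.
  by exists m, (z - m); split => //; rewrite addrC subrK.
- by move=> i; split; [exact: Einv | exact: perp_perp_invariant].
- by move=> i; exact: perp_perp_normal.
move=> j l /= nl; apply: contrapT => /eqP l0; apply: nl.
(* Only injectivity of [A j - l] on [perp ip E] is left. An eigenvector there would make [F]
   nonzero, and a joint eigenvector in [F] would lie both in [E] and in its complement. *)
apply: (fredholm_alternative ipP (cA j) l0 Esub (Einv j)) => x Ex Ax.
apply: contrapT => /eqP x0.
pose F := perp ip E `&` [set y | A j y = l *: y].
have Fsub : closed_subspace F.
  by apply: closed_subspaceI => //; exact: closed_eigenspace.
have FA i : invariant_under (A i) F.
  move=> y [Ey Ay]; split; first exact: Einv.
  by rewrite /= Acomm Ay (linear_op_scale (Alin i)).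
have [||v [Ev _] [/eqP v0 vE]] :=
    joint_eigenvector_exists ipP cA Acomm (cA j) l0 Fsub _ FA _.
- by move=> y [].
- by exists x.
by apply/v0/(perp_self_eq0 ipP (E := E)).
Qed.
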